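(* Let $d\ge 2$, $N\ge 4$, $\ell>0$, and let $m\in\{2,\dots,[\frac{N}{2}]\}$. For an equilateral polygon $\mathcal{P}_N=\{y_1,\dots,y_N\}\subset\mathbb{R}^d$ with edge length $\ell$ let $\mathcal{D}_m(\mathcal{P}_N)$ denote the sum of lengths of all its $m$-diagonals, i.e. of the segments $[y_i,y_{i+m}]$. Then the property $(P_m)$ holds locally: there is a neighbourhood of the regular polygon $\tilde{\mathcal{P}}_N$ in the set of equilateral polygons in $\mathbb{R}^d$ with edge length $\ell$ such that $\mathcal{D}_m(\mathcal{P}_N)<\mathcal{D}_m(\tilde{\mathcal{P}}_N)$ for every $\mathcal{P}_N$ in this neighbourhood which is not a regular polygon (i.e. not the image of $\tilde{\mathcal{P}}_N$ under a Euclidean transformation).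
   Context: A polygon is identified with the ordered set of its vertices $\{y_1,\dots,y_N\}$, indices taken mod $N$; it is equilateral with edge length $\ell$ if $|y_{i+1}-y_i|=\ell$ for all $i$. The regular polygon $\tilde{\mathcal{P}}_N$ of edge length $\ell$ is the planar convex regular $N$-gon with consecutive vertices adjacent, lying on a circle of radius $\ell\,(2\sin\frac{\pi}{N})^{-1}$, determined up to Euclidean transformations. Property $(P_m)$: the quantity $\mathcal{D}_m$ is, in the set of equilateral polygons in $\mathbb{R}^d$ with fixed edge length $\ell$, uniquely maximized (up to Euclidean transformations) by the regular polygon. *)

(* Defs.v *)
From HB Require Import structures.
From mathcomp Require Import all_boot all_order all_algebra.
From mathcomp Require Import reals trigo.
Set Implicit Arguments. Unset Strict Implicit. Unset Printing Implicit Defensive.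
Import Order.TTheory GRing.Theory Num.Theory.
Local Open Scope ring_scope.

Section Polygons.
Variable R : realType.

Definition enorm (d : nat) (v : 'rV[R]_d) : R :=
  Num.sqrt (\sum_(j < d) (v ord0 j) ^+ 2).

Definition polygon (d N : nat) := 'I_N -> 'rV[R]_d.

Definition shift (N : nat) (i : 'I_N) (k : nat) : 'I_N :=
  Ordinal (ltn_pmod (i + k)%N (leq_ltn_trans (leq0n i) (ltn_ord i))).

Definition equilateral (d N : nat) (l : R) (P : polygon d N) : Prop :=
  forall i : 'I_N, enorm (P (shift i 1) - P i) = l.

Definition Dm (d N : nat) (m : nat) (P : polygon d N) : R :=
  \sum_(i < N) enorm (P (shift i m) - P i).

Definition regular_std (d N : nat) (l : R) : polygon d N :=
  fun k => \row_(j < d)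
    (if (j == 0 :> nat) then
       (l / (2 * sin (pi / N%:R))) * cos (2 * pi * (k : nat)%:R / N%:R)
     else if (j == 1 :> nat) then
       (l / (2 * sin (pi / N%:R))) * sin (2 * pi * (k : nat)%:R / N%:R)
     else 0).

Definition euclid_image (d N : nat) (P Q : polygon d N) : Prop :=
  exists (A : 'M[R]_d) (b : 'rV[R]_d),
    A *m A^T = 1%:M /\ forall i : 'I_N, Q i = P i *m A + b.

Definition is_regular (d N : nat) (l : R) (P : polygon d N) : Prop :=
  euclid_image (@regular_std d N l) P.

Definition poly_close (d N : nat) (P Q : polygon d N) (e : R) : Prop :=
  forall i : 'I_N, enorm (P i - Q i) < e.

End Polygons.

Arguments regular_std {R} d N l k.

(* Main.v *)
(** The bound is in fact global. Expand the vertices in their discrete Fourier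
    modes: with [t = pi / N] and [E_k] the energy of mode [k], Parseval gives
    [N * sum_j |y_(j+m) - y_j|^2 = sum_k 4 sin^2 (m k t) E_k]. For
    [2 <= k <= N - 2] one has [|sin (m k t)| sin t < sin (m t) sin (k t)], with
    equality for [k = 1, N - 1], so the mean square of the [m]-diagonals of an
    equilateral polygon is at most [q^2], where [q] is the [m]-diagonal of the
    regular one; hence their mean is at most [q]. In the case of equality only
    the modes [0, 1, N - 1] survive, i.e. the vertices lie on an affine image of
    the regular polygon, and all [m]-diagonals are equal. Comparing a few edges
    and diagonals forces that affine map to be a similarity. *)

Require Import Defs.
From HB Require Import structures.
From mathcomp Require Import all_boot all_order all_algebra.
From mathcomp Require Import reals trigo.
From mathcomp Require Import zify ring lra.
Set Implicit Arguments. Unset Strict Implicit. Unset Printing Implicit Defensive.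
Import Order.TTheory GRing.Theory Num.Theory.
Local Open Scope ring_scope.

(** * Trigonometric inequalities for multiple angles *)

Lemma cosDn2pi (R : realType) (x : R) (n : nat) :
  cos (x + 2 * n%:R * pi) = cos x.
Proof.
have -> : 2 * n%:R * pi = (pi *+ 2) *+ n :> R by rewrite -mulrnA -[RHS]mulr_natl natrM.
by rewrite periodicn //; exact: cosD2pi.
Qed.

Lemma sinDn2pi (R : realType) (x : R) (n : nat) :
  sin (x + 2 * n%:R * pi) = sin x.
Proof.
have -> : 2 * n%:R * pi = (pi *+ 2) *+ n :> R by rewrite -mulrnA -[RHS]mulr_natl natrM.
by rewrite periodicn //; exact: sinD2pi.
Qed.

Lemma cos2x (R : realType) (x : R) : cos (2 * x) = 1 - 2 * sin x ^+ 2.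
Proof.
rewrite mulr_natl cos_mulr2n -mulr_natl cos2sin2; ring.
Qed.

(** Induction on [m] through the addition formula for [sin (n x + x)]. The term with [sin (n x)] is
    controlled by the induction hypothesis and [cos x < cos t], the term with [cos (n x)] by the
    monotonicity of cosine on [[0, pi]]; this is where [m x <= pi] enters. *)
Lemma ltr_sin_mul (R : realType) (m : nat) (t x : R) :
  (2 <= m)%N -> 0 < t -> t < x -> x <= pi / 2 -> m%:R * x <= pi ->
  sin (m%:R * x) * sin t < sin (m%:R * t) * sin x.
Proof.
move=> m2 t0 tx xpi.
have p0 := pi_gt0 R.
have sx0 : 0 < sin x by apply: sin_gt0_pi; apply/andP; split; lra.
have st0 : 0 < sin t by apply: sin_gt0_pi; apply/andP; split; lra.
have ct : cos x < cos t by rewrite ltr_cos ?in_itv //=; apply/andP; split; lra.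
have cx : 0 <= cos x by apply: cos_ge0_pihalf; apply/andP; split; lra.
elim: m m2 => // -[//|[_ _ _|m IH _]].
  have : cos x * (sin x * sin t) < cos t * (sin x * sin t).
    by rewrite ltr_pM2r // mulr_gt0.
  by rewrite !mulr_natl !sin_mulr2n -![(_ * _) *+ 2]mulr_natl; lra.
move: m.+2 (isT : (1 < m.+2)%N) IH => n n2 /(_ n2) IH.
rewrite -natr1 !mulrDl !mul1r => le_pi.
have n0 : 0 <= n%:R :> R by [].
have n1 : 1 <= n%:R :> R by rewrite ler1n ltnW.
have nt : n%:R * t <= n%:R * x by rewrite ler_wpM2l // ltW.
have nt0 : 0 <= n%:R * t by rewrite mulr_ge0 // ltW.
have {}IH : sin (n%:R * x) * sin t < sin (n%:R * t) * sin x by apply: IH => //; lra.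
have snx : 0 <= sin (n%:R * x) by apply: sin_ge0_pi; apply/andP; split; lra.
have snt : 0 <= sin (n%:R * t) by apply: sin_ge0_pi; apply/andP; split; lra.
have cn : cos (n%:R * x) <= cos (n%:R * t).
  rewrite leNgt ltr_cos ?in_itv /= -?leNgt //; apply/andP; split; lra.
rewrite !sinD !mulrDl; apply: ltr_leD.
  have A : sin (n%:R * x) * sin t * cos x <= sin (n%:R * t) * sin x * cos x by rewrite ler_wpM2r // ltW.
  have B : sin (n%:R * t) * sin x * cos x < sin (n%:R * t) * sin x * cos t.
    rewrite ltr_pM2l //; apply: le_lt_trans IH; rewrite mulr_ge0 // ltW //.
  lra.
have : cos (n%:R * x) * (sin x * sin t) <= cos (n%:R * t) * (sin x * sin t).
  by rewrite ler_wpM2r // mulr_ge0 // ltW.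
lra.
Qed.

(* Past [m x = pi] the left side is at most [sin t], and [ltr_sin_mul] at
   [pi / (2 m)] bounds [sin t] by [sin (m t) * sin (pi / (2 m))]. *)
Lemma ltr_norm_sin_mul_pihalf (R : realType) (m : nat) (t x : R) :
  (2 <= m)%N -> 0 < t -> t < x -> x <= pi / 2 -> m%:R * t <= pi / 2 ->
  `|sin (m%:R * x)| * sin t < sin (m%:R * t) * sin x.
Proof.
move=> m2 t0 tx xpi mt.
have p0 := pi_gt0 R.
have m2' : 2 <= m%:R :> R by rewrite ler_nat.
have m0 : 0 < m%:R :> R by lra.
have st0 : 0 < sin t by apply: sin_gt0_pi; apply/andP; split; lra.
have smt0 : 0 < sin (m%:R * t).
  by apply: sin_gt0_pi; apply/andP; split; [rewrite mulr_gt0|lra].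
case: (leP (m%:R * x) pi) => mx.
  rewrite ger0_norm; first exact: ltr_sin_mul.
  apply: sin_ge0_pi; rewrite mx andbT mulr_ge0 //; lra.
pose z : R := pi / (2 * m%:R).
have mz : m%:R * z = pi / 2 by rewrite /z; field; rewrite gt_eqF.
have z0 : 0 < z by rewrite /z divr_gt0 // mulr_gt0.
have zx : z < x by rewrite -(ltr_pM2l m0) mz; lra.
have zle : t <= z by rewrite -(ler_pM2l m0) mz.
have h : sin t <= sin (m%:R * t) * sin z.
  move: zle; rewrite le_eqVlt => /orP[/eqP->|tz].
    by rewrite mz sin_pihalf mul1r.
  have zpi : z <= pi / 2 by lra.
  have mzpi : m%:R * z <= pi by lra.
  by have := ltr_sin_mul m2 t0 tz zpi mzpi; rewrite mz sin_pihalf mul1r => /ltW.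
have sz : sin z < sin x by rewrite ltr_sin // in_itv /=; apply/andP; split; lra.
have A : `|sin (m%:R * x)| * sin t <= sin t by rewrite ger_pMl // sin_max.
have B : sin (m%:R * t) * sin z < sin (m%:R * t) * sin x by rewrite ltr_pM2l.
lra.
Qed.

Lemma norm_sin_natpiB (R : realType) (m : nat) (x : R) :
  `|sin (m%:R * (pi - x))| = `|sin (m%:R * x)|.
Proof.
have -> : m%:R * (pi - x) = - (m%:R * x) + pi *+ m.
  by rewrite -[pi *+ m]mulr_natl; ring.
by rewrite (alternatingn (@sinDpi R)) normrM normrX normrN1 expr1n mul1r sinN normrN.
Qed.

(** Both sides are invariant under [x -> pi - x], which reduces the range to [x <= pi / 2]. *)
Lemma ltr_norm_sin_mul (R : realType) (m : nat) (t x : R) :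
  (2 <= m)%N -> 0 < t -> t < x -> x < pi - t -> m%:R * t <= pi / 2 ->
  `|sin (m%:R * x)| * sin t < sin (m%:R * t) * sin x.
Proof.
move=> m2 t0 tx xt mt.
case: (leP x (pi / 2)) => hx; first exact: ltr_norm_sin_mul_pihalf.
rewrite -norm_sin_natpiB.
have -> : sin x = sin (pi - x) by rewrite sinB sinpi cospi; ring.
by apply: ltr_norm_sin_mul_pihalf => //; lra.
Qed.

(** * Real discrete Fourier transform on [N] points *)

Lemma sin_npi_gt0 (R : realType) (N k : nat) :
  (0 < k < N)%N -> 0 < sin (k%:R * (pi / N%:R)) :> R.
Proof.
move=> /andP[k0 kN]; apply: sin_gt0_pi.
have N0 : 0 < N%:R :> R by rewrite ltr0n; lia.
rewrite mulr_gt0 ?ltr0n //= ?divr_gt0 ?pi_gt0 //.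
rewrite mulrA ltr_pdivrMr // mulrC ltr_pM2l ?pi_gt0 //.
by rewrite ltr_nat.
Qed.

(** Multiplied by [2 sin (n t)], the sum telescopes; over a full period the end terms cancel, and
    [sin (n t)] is nonzero for [0 < n < N]. *)
Lemma sum_cos_eq0 (R : realType) (N n : nat) : (0 < n < N)%N ->
  \sum_(k < N) cos (2 * (n * k)%:R * (pi / N%:R)) = 0 :> R.
Proof.
move=> nN; set t : R := pi / N%:R.
have N0 : N%:R != 0 :> R by rewrite pnatr_eq0; lia.
have s0 := sin_npi_gt0 R nN; rewrite -/t in s0.
have tel M : 2 * sin (n%:R * t) * (\sum_(k < M) cos (2 * (n * k)%:R * t)) =
  sin (2 * (n * M)%:R * t - n%:R * t) + sin (n%:R * t).
  elim: M => [|M IH]; first by rewrite big_ord0 muln0 !mulr0 mul0r sub0r sinN addNr.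
  rewrite big_ord_recr /= mulrDr IH.
  have -> : 2 * (n * M.+1)%:R * t - n%:R * t = 2 * (n * M)%:R * t + n%:R * t.
    by rewrite mulnS natrD; ring.
  rewrite sinB sinD; ring.
have := tel N; have -> : 2 * (n * N)%:R * t - n%:R * t = - (n%:R * t) + 2 * n%:R * pi.
  by rewrite /t natrM; field.
rewrite sinDn2pi sinN addNr => /eqP; rewrite mulf_eq0 mulf_eq0 (gt_eqF s0) pnatr_eq0 /=.
by move/eqP.
Qed.

(** Orthogonality of the modes. The cosine of a difference packs the products of cosines and of
    sines together, in place of complex exponentials. *)
Lemma sum_cos_sub (R : realType) (N i j : nat) : (i < N)%N -> (j < N)%N ->
  \sum_(k < N) cos (2 * (i * k)%:R * (pi / N%:R) - 2 * (j * k)%:R * (pi / N%:R))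
  = N%:R *+ (i == j) :> R.
Proof.
wlog ij : i j / (i <= j)%N.
  move=> H iN jN; case: (leqP i j) => [/H|/ltnW/H]; first exact.
  move=> /(_ jN iN); rewrite eq_sym => <-; apply: eq_bigr => k _.
  by rewrite -cosN opprB.
move=> iN jN; case: eqVneq => [->|ne].
  under eq_bigr do rewrite subrr cos0.
  by rewrite sumr_const card_ord.
have ji : (0 < j - i < N)%N by lia.
rewrite mulr0n -[RHS](sum_cos_eq0 R ji).
apply: eq_bigr => k _; rewrite -cosN; congr cos.
by rewrite mulnBl natrB ?leq_mul2r ?ij ?orbT //; ring.
Qed.

(** Together with [dft_sin], the real and imaginary parts, up to sign, of the unnormalised [k]-th
    Fourier coefficient. *)
Definition dft_cos (R : realType) (N : nat) (y : nat -> R) (k : nat) : R :=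
  \sum_(j < N) y j * cos (2 * (j * k)%:R * (pi / N%:R)).

Definition dft_sin (R : realType) (N : nat) (y : nat -> R) (k : nat) : R :=
  \sum_(j < N) y j * sin (2 * (j * k)%:R * (pi / N%:R)).

Definition dft_energy (R : realType) (N : nat) (y : nat -> R) (k : nat) : R :=
  dft_cos N y k ^+ 2 + dft_sin N y k ^+ 2.

Lemma dft_inversion (R : realType) (N : nat) (y : nat -> R) (j : nat) :
  (j < N)%N ->
  \sum_(k < N) (dft_cos N y k * cos (2 * (j * k)%:R * (pi / N%:R)) +
                dft_sin N y k * sin (2 * (j * k)%:R * (pi / N%:R))) = N%:R * y j.
Proof.
move=> jN.
under eq_bigr => k _ do rewrite /dft_cos /dft_sin !mulr_suml -big_split /=.
rewrite exchange_big /= (bigD1 (Ordinal jN)) //= [X in _ + X]big1 => [|i ne].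
  have E := sum_cos_sub R jN jN; rewrite eqxx mulr1n in E.
  rewrite addr0 [RHS]mulrC -[X in _ = _ * X]E mulr_sumr.
  by apply: eq_bigr => k _; rewrite cosB; ring.
transitivity (y i * \sum_(k < N) cos (2 * (i * k)%:R * (pi / N%:R) - 2 * (j * k)%:R * (pi / N%:R))).
  by rewrite mulr_sumr; apply: eq_bigr => k _; rewrite cosB; ring.
have ne' : (i == j :> nat) = false by apply/negbTE; apply: contra ne => /eqP ij; apply/eqP/val_inj.
by rewrite sum_cos_sub // ne' mulr0n mulr0.
Qed.

Lemma dft_parseval (R : realType) (N : nat) (y : nat -> R) :
  \sum_(k < N) dft_energy N y k = N%:R * \sum_(j < N) y j ^+ 2.
Proof.
rewrite mulr_sumr.
(* Only one factor of each square is expanded by the inversion formula; exchanging the sums turns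
   the other into a Fourier coefficient. *)
transitivity (\sum_(j < N) y j * (N%:R * y j)); last by apply: eq_bigr => j _; ring.
under [RHS]eq_bigr => j _ do rewrite -(dft_inversion y (ltn_ord j)) mulr_sumr.
rewrite exchange_big /=; apply: eq_bigr => k _.
rewrite /dft_energy !expr2 {1}/dft_cos {1}/dft_sin !mulr_suml -big_split /=.
by apply: eq_bigr => j _; ring.
Qed.

Lemma sum_periodic (R : realType) (N m : nat) (g : nat -> R) :
  (forall j, g (j + N)%N = g j) -> \sum_(j < N) g (j + m)%N = \sum_(j < N) g j.
Proof.
move=> gN; elim: m => [|m IH]; first by under eq_bigr do rewrite addn0.
rewrite -IH; case: N gN {IH} => [|N] gN; first by rewrite !big_ord0.
rewrite big_ord_recr [RHS]big_ord_recl /= addrC; congr (_ + _).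
  by rewrite add0n -(gN m); congr g; lia.
by apply: eq_bigr => j _; congr g; rewrite /bump /=; lia.
Qed.

(** Shifting the sequence by [m] rotates the coefficient pair by the angle [2 m k t]. Subtracting
    the original pair multiplies its squared norm by [2 - 2 cos (2 m k t) = 4 sin^2 (m k t)]. *)
Lemma dft_energy_diff (R : realType) (N m : nat) (y : nat -> R) (k : nat) :
  (0 < N)%N -> (forall j, y (j + N)%N = y j) ->
  dft_energy N (fun j => y (j + m)%N - y j) k =
  4 * sin (m%:R * (k%:R * (pi / N%:R))) ^+ 2 * dft_energy N y k.
Proof.
move=> N0 yN; rewrite /dft_energy /dft_cos /dft_sin; set t := pi / N%:R.
have N0' : N%:R != 0 :> R by rewrite pnatr_eq0; lia.
pose a j : R := 2 * (j * k)%:R * t.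
have aN j : a (j + N)%N = a j + 2 * k%:R * pi.
  by rewrite /a mulnDl natrD /t !natrM; field.
have aD j : a (j + m)%N = a j + a m by rewrite /a mulnDl natrD; ring.
have Hc : \sum_(j < N) y (j + m)%N * cos (a (j + m)%N) = \sum_(j < N) y j * cos (a j).
  by apply: (@sum_periodic R N m (fun j => y j * cos (a j))) => j; rewrite yN aN cosDn2pi.
have Hs : \sum_(j < N) y (j + m)%N * sin (a (j + m)%N) = \sum_(j < N) y j * sin (a j).
  by apply: (@sum_periodic R N m (fun j => y j * sin (a j))) => j; rewrite yN aN sinDn2pi.
rewrite -/(a _).
set c := \sum_(j < N) y j * cos _ in Hc *; set s := \sum_(j < N) y j * sin _ in Hs *.
have -> : \sum_(j < N) (y (j + m)%N - y j) * cos (2 * (j * k)%:R * t) =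
    cos (a m) * c + sin (a m) * s - c.
  rewrite -{1}Hc -Hs !mulr_sumr /c -sumrN -!big_split /=; apply: eq_bigr => j _.
  have -> : 2 * (j * k)%:R * t = a (j + m)%N - a m by rewrite aD; rewrite /a; ring.
  rewrite mulrBl; congr (_ - _); last by rewrite aD addrK.
  by rewrite cosB; ring.
have -> : \sum_(j < N) (y (j + m)%N - y j) * sin (2 * (j * k)%:R * t) =
    cos (a m) * s - sin (a m) * c - s.
  rewrite -{1}Hs -Hc !mulr_sumr /s -!sumrN -!big_split /=; apply: eq_bigr => j _.
  have -> : 2 * (j * k)%:R * t = a (j + m)%N - a m by rewrite aD; rewrite /a; ring.
  rewrite mulrBl; congr (_ - _); last by rewrite aD addrK.
  by rewrite sinB; ring.
have E : cos (a m) = 1 - 2 * sin (m%:R * (k%:R * t)) ^+ 2.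
  by rewrite -cos2x /a natrM; congr cos; ring.
transitivity ((2 - 2 * cos (a m)) * (c ^+ 2 + s ^+ 2)).
  have := cos2Dsin2 (a m); set C := cos _; set S := sin _ => CS.
  transitivity ((C ^+ 2 + S ^+ 2 + 1 - 2 * C) * (c ^+ 2 + s ^+ 2)); first by ring.
  by rewrite CS; ring.
by rewrite E; ring.
Qed.

(** The condition on [k] places [k t] strictly between [t] and [pi - t], and [m <= N / 2] gives
    [m t <= pi / 2], as [ltr_norm_sin_mul] requires. *)
Lemma chord_weight_gt0 (R : realType) (N m k : nat) (t := pi / N%:R : R) :
  (2 <= m)%N -> (m <= N./2)%N -> (1 < k < N.-1)%N ->
  (sin t * sin (m%:R * (k%:R * t))) ^+ 2 < (sin (m%:R * t) * sin (k%:R * t)) ^+ 2.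
Proof.
move=> m2 mN kN.
have N0 : 0 < N%:R :> R by rewrite ltr0n; lia.
have p0 := pi_gt0 R.
have t0 : 0 < t by rewrite divr_gt0.
have NtE : N%:R * t = pi by rewrite /t; field; rewrite gt_eqF.
have st0 : 0 < sin t by rewrite -[t]mul1r; apply: (@sin_npi_gt0 R N 1); lia.
have tk : t < k%:R * t by rewrite ltr_pMl // ltr1n; lia.
have kt : k%:R * t < pi - t.
  have : k.+1%:R * t < N%:R * t by rewrite ltr_pM2r // ltr_nat; lia.
  by rewrite NtE -natr1 mulrDl mul1r; lra.
have mt : m%:R * t <= pi / 2.
  have : (2 * m)%:R * t <= N%:R * t by rewrite ler_pM2r // ler_nat; lia.
  by rewrite NtE natrM; lra.
have := ltr_norm_sin_mul m2 t0 tk kt mt.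
rewrite mulrC -{1}(gtr0_norm st0) -normrM => lt.
have pos := ltW (le_lt_trans (normr_ge0 _) lt).
by rewrite -[ltLHS]real_normK ?num_real // ltr_sqr.
Qed.

(** The modes [0], [1] and [N - 1] left out by the strict version all give equality; for the last,
    [k t = pi - t]. *)
Lemma chord_weight_ge0 (R : realType) (N m k : nat) (t := pi / N%:R : R) :
  (2 <= m)%N -> (m <= N./2)%N -> (k < N)%N ->
  (sin t * sin (m%:R * (k%:R * t))) ^+ 2 <= (sin (m%:R * t) * sin (k%:R * t)) ^+ 2.
Proof.
move=> m2 mN kN.
have [->|k0] := eqVneq k 0%N; first by rewrite !mul0r !mulr0 sin0 !mulr0.
have [->|k1] := eqVneq k 1%N; first by rewrite !mul1r mulrC.
have [kE|kN1] := eqVneq k N.-1; last by apply/ltW/chord_weight_gt0 => //; lia.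
have -> : k%:R * t = pi - t.
  have -> : k = (N - 1)%N by lia.
  by rewrite natrB ?/t; [field; rewrite pnatr_eq0|]; lia.
have sE : sin (pi - t) = sin t by rewrite sinB sinpi cospi; ring.
by rewrite !exprMn sE -[sin (m%:R * (pi - t)) ^+ 2]real_normK ?num_real //
  norm_sin_natpiB real_normK ?num_real // mulrC.
Qed.

(** * Inner product and reflections *)

Definition dot (R : realType) (d : nat) (u v : 'rV[R]_d) : R :=
  \sum_(c < d) u ord0 c * v ord0 c.

Lemma dotC (R : realType) (d : nat) (u v : 'rV[R]_d) : dot u v = dot v u.
Proof. by apply: eq_bigr => c _; rewrite mulrC. Qed.

Lemma dotDl (R : realType) (d : nat) (u v w : 'rV[R]_d) :
  dot (u + v) w = dot u w + dot v w.
Proof. by rewrite -big_split; apply: eq_bigr => c _; rewrite mxE mulrDl. Qed.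

Lemma dotZl (R : realType) (d : nat) (a : R) (u w : 'rV[R]_d) :
  dot (a *: u) w = a * dot u w.
Proof. by rewrite mulr_sumr; apply: eq_bigr => c _; rewrite mxE mulrA. Qed.

Lemma dotDr (R : realType) (d : nat) (u v w : 'rV[R]_d) :
  dot w (u + v) = dot w u + dot w v.
Proof. by rewrite dotC dotDl !(dotC w). Qed.

Lemma dotZr (R : realType) (d : nat) (a : R) (u w : 'rV[R]_d) :
  dot w (a *: u) = a * dot w u.
Proof. by rewrite dotC dotZl dotC. Qed.

Lemma dotBr (R : realType) (d : nat) (u v w : 'rV[R]_d) :
  dot w (u - v) = dot w u - dot w v.
Proof. by rewrite dotDr -scaleN1r dotZr mulN1r. Qed.

Lemma dot_delta (R : realType) (d : nat) (i j : 'I_d) :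
  dot (delta_mx ord0 i) (delta_mx ord0 j) = (i == j)%:R :> R.
Proof.
rewrite /dot (bigD1 i) //= big1 ?addr0 => [|k ne]; rewrite !mxE eqxx /=.
  by rewrite eqxx mul1r.
by rewrite (negbTE ne) mul0r.
Qed.

Lemma dot_mulmx (R : realType) (d : nat) (u v : 'rV[R]_d) :
  u *m v^T = (dot u v)%:M.
Proof.
rewrite [LHS]mx11_scalar mxE; congr (_%:M).
by apply: eq_bigr => c _; rewrite mxE.
Qed.

Lemma dot_eq0 (R : realType) (d : nat) (u : 'rV[R]_d) : dot u u = 0 -> u = 0.
Proof.
move=> /eqP; rewrite psumr_eq0 => [/allP h|c _]; last by rewrite -expr2 sqr_ge0.
apply/rowP => c; rewrite mxE; apply/eqP.
by have := h c (mem_index_enum c); rewrite /= mulf_eq0 orbb.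
Qed.

Lemma enorm_ge0 (R : realType) (d : nat) (u : 'rV[R]_d) : 0 <= enorm u.
Proof. exact: sqrtr_ge0. Qed.

Lemma enorm_sqr (R : realType) (d : nat) (u : 'rV[R]_d) : enorm u ^+ 2 = dot u u.
Proof.
rewrite sqr_sqrtr; first by apply: eq_bigr => c _; rewrite expr2.
by apply: sumr_ge0 => c _; rewrite sqr_ge0.
Qed.

(* The Householder reflection exchanging [a] and [b]. *)
Lemma exists_reflection (R : realType) (d : nat) (a b : 'rV[R]_d) :
  dot a a = dot b b ->
  exists A : 'M[R]_d, [/\ A *m A^T = 1%:M, a *m A = b &
    forall c, dot c a = dot c b -> c *m A = c].
Proof.
move=> ab; set w := a - b; set s := dot w w.
have [s0|s0] := eqVneq s 0.
  have /eqP := dot_eq0 s0; rewrite subr_eq0 => /eqP <-.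
  by exists 1%:M; split=> [||c _]; rewrite ?trmx1 ?mulmx1.
have cA c : c *m (1%:M - (2 / s) *: (w^T *m w)) = c - (2 / s * dot c w) *: w.
  by rewrite mulmxBr mulmx1 -scalemxAr mulmxA dot_mulmx mul_scalar_mx scalerA.
exists (1%:M - (2 / s) *: (w^T *m w)); split=> [||c cab].
- have MT : (w^T *m w)^T = w^T *m w by rewrite trmx_mul trmxK.
  have MM : (w^T *m w) *m (w^T *m w) = s *: (w^T *m w).
    by rewrite mulmxA -(mulmxA w^T) dot_mulmx mul_mx_scalar -scalemxAl.
  move: (w^T *m w) MT MM => M MT MM.
  rewrite [(1%:M - _)^T]linearB /= trmx1 [(_ *: M)^T]linearZ /= MT mulmxBr mulmx1 mulmxBl.
  rewrite mul1mx -scalemxAl -scalemxAr MM !scalerA.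
  have -> : 2 / s * (2 / s) * s = 2 / s + 2 / s by field.
  by rewrite scalerDl opprB addrK subrK.
- rewrite cA; have -> : 2 / s * dot a w = 1.
    have sE : s = 2 * dot a w.
      by rewrite /s {1}/w -scaleN1r dotDl dotZl !dotBr ab (dotC b a); ring.
    rewrite sE; field; move: s0; rewrite sE; apply: contra => /eqP->; by rewrite mulr0.
  by rewrite scale1r opprB addrC subrK.
- by rewrite cA dotBr cab subrr mulr0 scale0r subr0.
Qed.

(** * Sums of squared chords in Fourier modes *)

Definition dft_energy_rV (R : realType) (d N : nat) (Y : nat -> 'rV[R]_d) (k : nat) : R :=
  \sum_(c < d) dft_energy N (fun j => Y j ord0 c) k.

Lemma dft_energy_ge0 (R : realType) (N : nat) (y : nat -> R) (k : nat) :
  0 <= dft_energy N y k.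
Proof. by rewrite addr_ge0 ?sqr_ge0. Qed.

Lemma dft_energy_rV_ge0 (R : realType) (d N : nat) (Y : nat -> 'rV[R]_d) (k : nat) :
  0 <= dft_energy_rV N Y k.
Proof. by apply: sumr_ge0 => c _; exact: dft_energy_ge0. Qed.

(** Parseval, coordinate by coordinate, for the difference sequence, whose energies come from
    [dft_energy_diff]. *)
Lemma sum_sqr_chords (R : realType) (d N m : nat) (Y : nat -> 'rV[R]_d) :
  (0 < N)%N -> (forall j, Y (j + N)%N = Y j) ->
  N%:R * (\sum_(j < N) dot (Y (j + m)%N - Y j) (Y (j + m)%N - Y j)) =
  \sum_(k < N) 4 * sin (m%:R * (k%:R * (pi / N%:R))) ^+ 2 * dft_energy_rV N Y k.
Proof.
move=> N0 YN; rewrite exchange_big /= mulr_sumr.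
under [RHS]eq_bigr do rewrite mulr_sumr.
rewrite [RHS]exchange_big /=; apply: eq_bigr => c _.
have yN j : Y (j + N)%N ord0 c = Y j ord0 c by rewrite YN.
under [RHS]eq_bigr => k _ do rewrite -(dft_energy_diff m k N0 yN).
rewrite dft_parseval; congr (_ * _); apply: eq_bigr => j _.
by rewrite !mxE expr2.
Qed.

(** The factors [sin^2 (m t)] and [sin^2 t] are in the ratio of squared diagonal to squared edge of
    the regular polygon, so the left side vanishes on it. The expansion serves both the inequality
    and its equality case. *)
Lemma sum_sqr_chords_deficit (R : realType) (d N m : nat) (Y : nat -> 'rV[R]_d)
    (t := pi / N%:R) :
  (0 < N)%N -> (forall j, Y (j + N)%N = Y j) ->
  N%:R * (sin (m%:R * t) ^+ 2 * (\sum_(j < N) dot (Y (j + 1)%N - Y j) (Y (j + 1)%N - Y j))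
        - sin t ^+ 2 * (\sum_(j < N) dot (Y (j + m)%N - Y j) (Y (j + m)%N - Y j))) =
  \sum_(k < N) 4 * ((sin (m%:R * t) * sin (k%:R * t)) ^+ 2
                    - (sin t * sin (m%:R * (k%:R * t))) ^+ 2) * dft_energy_rV N Y k.
Proof.
move=> N0 YN; rewrite mulrBr !(mulrCA N%:R) !sum_sqr_chords // !mulr_sumr -sumrB.
by apply: eq_bigr => k _; rewrite mul1r -/t; ring.
Qed.

Lemma sum_sqr_chords_le (R : realType) (d N m : nat) (Y : nat -> 'rV[R]_d)
    (t := pi / N%:R) :
  (2 <= m)%N -> (m <= N./2)%N -> (forall j, Y (j + N)%N = Y j) ->
  sin t ^+ 2 * (\sum_(j < N) dot (Y (j + m)%N - Y j) (Y (j + m)%N - Y j)) <=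
  sin (m%:R * t) ^+ 2 * (\sum_(j < N) dot (Y (j + 1)%N - Y j) (Y (j + 1)%N - Y j)).
Proof.
move=> m2 mN YN; have N0 : (0 < N)%N by lia.
rewrite -subr_ge0 -(@pmulr_rge0 _ N%:R) ?ltr0n // sum_sqr_chords_deficit //.
apply: sumr_ge0 => k _; rewrite mulr_ge0 ?dft_energy_rV_ge0 // mulr_ge0 // subr_ge0.
exact: chord_weight_ge0.
Qed.

(** The deficit is a sum of non-negative terms that is now at most zero, so every term vanishes;
    where the weight is positive, the energy must vanish, in each coordinate separately. *)
Lemma dft_energy_eq0_of_sum_sqr_chords_ge (R : realType) (d N m : nat)
    (Y : nat -> 'rV[R]_d) (t := pi / N%:R) :
  (2 <= m)%N -> (m <= N./2)%N -> (forall j, Y (j + N)%N = Y j) ->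
  sin (m%:R * t) ^+ 2 * (\sum_(j < N) dot (Y (j + 1)%N - Y j) (Y (j + 1)%N - Y j)) <=
  sin t ^+ 2 * (\sum_(j < N) dot (Y (j + m)%N - Y j) (Y (j + m)%N - Y j)) ->
  forall k (c : 'I_d), (1 < k < N.-1)%N -> dft_energy N (fun j => Y j ord0 c) k = 0.
Proof.
move=> m2 mN YN le k c kN; have N0 : (0 < N)%N by lia.
have kltN : (k < N)%N by lia.
have := sum_sqr_chords_deficit m N0 YN; set S := (X in N%:R * _ = X) => SE.
have h (i : 'I_N) : true -> 0 <= 4 * ((sin (m%:R * t) * sin (i%:R * t)) ^+ 2
    - (sin t * sin (m%:R * (i%:R * t))) ^+ 2) * dft_energy_rV N Y i.
  move=> _; rewrite mulr_ge0 ?dft_energy_rV_ge0 // mulr_ge0 // subr_ge0.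
  exact: chord_weight_ge0.
have S0 : S = 0.
  apply: le_anti; apply/andP; split; last by apply: sumr_ge0 => i _; exact: h.
  by rewrite -SE mulr_ge0_le0 ?ler0n // subr_le0.
have /eqP := S0; rewrite psumr_eq0 // => /allP /(_ (Ordinal kltN) (mem_index_enum _)) /=.
have := chord_weight_gt0 R m2 mN kN; rewrite -/t -subr_gt0 => w0.
rewrite !mulf_eq0 pnatr_eq0 (gt_eqF w0) /= psumr_eq0 => [/allP|i _]; last exact: dft_energy_ge0.
by move=> /(_ c (mem_index_enum c)) /eqP.
Qed.

(** * Equality case: from one Fourier mode to a circle *)

Lemma dft_energy_eq0 (R : realType) (N : nat) (y : nat -> R) (k : nat) :
  dft_energy N y k = 0 -> dft_cos N y k = 0 /\ dft_sin N y k = 0.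
Proof.
by move=> /eqP; rewrite paddr_eq0 ?sqr_ge0 // !sqrf_eq0 => /andP[/eqP ? /eqP ?].
Qed.

(** Mode [N - 1] is the conjugate of mode [1], since its angles are the opposite ones modulo [2 pi].
    The two contribute equally to the inversion formula, hence the factors [2]. *)
Lemma dft_one_mode (R : realType) (N : nat) (y : nat -> R) (j : nat) (t := pi / N%:R) :
  (4 <= N)%N -> (forall k, (1 < k < N.-1)%N -> dft_energy N y k = 0) -> (j < N)%N ->
  y j = dft_cos N y 0 / N%:R + cos (2 * j%:R * t) * (2 * dft_cos N y 1 / N%:R)
                             + sin (2 * j%:R * t) * (2 * dft_sin N y 1 / N%:R).
Proof.
move=> N4 E0 jN.
have N0 : N%:R != 0 :> R by rewrite pnatr_eq0; lia.
have angle i : 2 * (i * N.-1)%:R * t = - (2 * (i * 1)%:R * t) + 2 * i%:R * pi.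
  have -> : N.-1 = (N - 1)%N by lia.
  by rewrite muln1 natrM natrB; [rewrite /t; field | lia].
have cN : dft_cos N y N.-1 = dft_cos N y 1.
  by apply: eq_bigr => i _; rewrite -/t angle cosDn2pi cosN.
have sN : dft_sin N y N.-1 = - dft_sin N y 1.
  by rewrite -sumrN; apply: eq_bigr => i _; rewrite -/t angle sinDn2pi sinN mulrN.
apply: (mulfI N0); rewrite -(dft_inversion y jN) -/t.
have i0 : (0 < N)%N by lia.
have i1 : (1 < N)%N by lia.
have i2 : (N.-1 < N)%N by lia.
rewrite (bigD1 (Ordinal i0)) //= (bigD1 (Ordinal i1)) //= (bigD1 (Ordinal i2)) /=; last first.
  by rewrite -!val_eqE /=; lia.
rewrite big1 => [|k]; last first.
  rewrite -!val_eqE /= => kk; have [|-> ->] := @dft_energy_eq0 _ N y k; last by rewrite !mul0r addr0.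
  by apply: E0; have := ltn_ord k; lia.
rewrite cN sN angle cosDn2pi sinDn2pi cosN sinN !muln0 !mulr0 !mul0r cos0 sin0 muln1.
by field.
Qed.

(* [Y j = a + cos (2 j t) u + sin (2 j t) v] runs along an ellipse; its chords
   are [2 sin (m t)] times the ellipse point at angle [(2 j + m) t + pi / 2]. *)
Lemma dot_ellipse_chord (R : realType) (d : nat) (Y : nat -> 'rV[R]_d) (a u v : 'rV[R]_d)
    (t : R) (m j : nat) (x := (2 * j%:R + m%:R) * t) :
  (forall i, Y i = a + (cos (2 * i%:R * t) *: u + sin (2 * i%:R * t) *: v)) ->
  dot (Y (j + m)%N - Y j) (Y (j + m)%N - Y j) =
  4 * sin (m%:R * t) ^+ 2 *
    (sin x ^+ 2 * dot u u - 2 * sin x * cos x * dot u v + cos x ^+ 2 * dot v v).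
Proof.
move=> YE.
have -> : Y (j + m)%N - Y j = (2 * sin (m%:R * t)) *: ((- sin x) *: u + cos x *: v).
  have e1 : 2 * (j + m)%:R * t = x + m%:R * t by rewrite /x natrD; ring.
  have e2 : 2 * j%:R * t = x - m%:R * t by rewrite /x; ring.
  rewrite !YE e1 e2 cosD cosB sinD sinB; apply/rowP => c; rewrite !mxE; ring.
by rewrite dotZl dotZr !(dotDl, dotDr, dotZl, dotZr) (dotC v u); ring.
Qed.

Lemma sinD_mul_sinB (R : realType) (a b : R) :
  sin (a + b) * sin (a - b) = sin a ^+ 2 - sin b ^+ 2.
Proof.
rewrite sinD sinB; transitivity (sin a ^+ 2 * cos b ^+ 2 - cos a ^+ 2 * sin b ^+ 2).
  by ring.
by rewrite !cos2sin2; ring.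
Qed.

(* Equal edges make the ellipse a circle, except when [N = 4]: the rhombi are
   ruled out by the equality of the two diagonals. *)
Lemma equilateral_ellipse_circle (R : realType) (d N m : nat)
    (Y : nat -> 'rV[R]_d) (a u v : 'rV[R]_d) (l q : R) (t := pi / N%:R) :
  (4 <= N)%N -> (2 <= m)%N -> (m <= N./2)%N ->
  (forall i, Y i = a + (cos (2 * i%:R * t) *: u + sin (2 * i%:R * t) *: v)) ->
  (forall j, (j < N)%N -> dot (Y (j + 1)%N - Y j) (Y (j + 1)%N - Y j) = l ^+ 2) ->
  (forall j, (j < N)%N -> dot (Y (j + m)%N - Y j) (Y (j + m)%N - Y j) = q) ->
  [/\ dot u v = 0, dot u u = (l / (2 * sin t)) ^+ 2
    & dot v v = (l / (2 * sin t)) ^+ 2].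
Proof.
move=> N4 m2 mN YE H1 Hm.
have N0 : N%:R != 0 :> R by rewrite pnatr_eq0; lia.
have sk k : (0 < k < N)%N -> 0 < sin (k%:R * t) by exact: sin_npi_gt0.
have st : 0 < sin t by rewrite -[t]mul1r; apply: (sk 1%N); lia.
have s2t : sin (2 * t) = 2 * (cos t * sin t).
  by rewrite mulr_natl sin_mulr2n -[LHS]mulr_natl.
have ct : cos t != 0.
  have : 0 < sin (2 * t) by apply: sk; lia.
  by rewrite s2t; apply: contraTN => /eqP ->; rewrite mul0r mulr0 ltxx.
have i0 : (0 < N)%N by lia.
have iN : (N.-1 < N)%N by lia.
have i1 : (1 < N)%N by lia.
(* These edges have ellipse angles [t], [- t] and [3 t]. Comparing [t] with [- t] isolates
   [dot u v]; comparing [t] with [3 t] isolates [dot u u - dot v v]. *)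
have E0 := H1 _ i0; have EN := H1 _ iN; have E1 := H1 _ i1.
rewrite (dot_ellipse_chord 1 0 YE) in E0; rewrite (dot_ellipse_chord 1 _ YE) in EN.
rewrite (dot_ellipse_chord 1 1 YE) in E1.
have x0 : (2 * 0%:R + 1%:R) * t = t by ring.
have xN : (2 * N.-1%:R + 1%:R) * t = - t + 2 * 1%:R * pi.
  have -> : N.-1 = (N - 1)%N by lia.
  by rewrite natrB // /t; field.
have x1 : (2 * 1%:R + 1%:R) * t = 3 * t by ring.
rewrite x0 mul1r in E0; rewrite xN mul1r sinDn2pi cosDn2pi sinN cosN in EN.
rewrite x1 mul1r in E1.
have W : dot u v = 0.
  have : 16 * (sin t ^+ 3 * cos t) * dot u v = 0.
    by rewrite -(subrr (l ^+ 2)) -{1}EN -E0; ring.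
  move/eqP; rewrite !mulf_eq0 (gt_eqF st) (negbTE ct) pnatr_eq0 /=.
  by move/eqP.
rewrite W !mulr0 !subr0 in E0 E1.
have UV : dot u u = dot v v.
  have [N4E|N5] := eqVneq N 4%N.
    have mE : m = 2%N by lia.
    have D0 := Hm _ i0; have D1 := Hm _ i1; rewrite mE in D0 D1.
    rewrite (dot_ellipse_chord 2 0 YE) in D0; rewrite (dot_ellipse_chord 2 1 YE) in D1.
    (* For the square, [sin^2 (3 t) = sin^2 t], so the edges give nothing more; the diagonals at
       angles [pi / 2] and [pi] read off [dot u u] and [dot v v]. *)
    have y0 : (2 * 0%:R + 2%:R) * t = pi / 2 by rewrite /t N4E; field.
    have y1 : (2 * 1%:R + 2%:R) * t = pi by rewrite /t N4E; field.
    have y2 : 2%:R * t = pi / 2 by rewrite /t N4E; field.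
    rewrite y0 y2 sin_pihalf cos_pihalf in D0.
    rewrite y1 y2 sin_pihalf sinpi cospi in D1.
    lra.
  (* The difference factors as [sin (4 t) sin (2 t)], positive once [N >= 5]. *)
  have s0 : 0 < sin (3 * t) ^+ 2 - sin t ^+ 2.
    rewrite -sinD_mul_sinB.
    have -> : 3 * t + t = 4%:R * t by ring.
    have -> : 3 * t - t = 2%:R * t by ring.
    by rewrite mulr_gt0 //; apply: sk; lia.
  have : 4 * sin t ^+ 2 * ((sin (3 * t) ^+ 2 - sin t ^+ 2) * (dot u u - dot v v)) = 0.
    by rewrite -(subrr (l ^+ 2)) -{1}E1 -E0 !cos2sin2; ring.
  move/eqP; rewrite !mulf_eq0 (gt_eqF st) (gt_eqF s0) pnatr_eq0 /=.
  by rewrite subr_eq0 => /eqP.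
have U : dot u u = (l / (2 * sin t)) ^+ 2.
  rewrite -UV -mulrDl addrC cos2Dsin2 mul1r in E0.
  by rewrite exprMn -E0; field; rewrite gt_eqF.
by split; rewrite -?UV.
Qed.

(** * Polygons as periodic sequences, and the regular polygon *)

Definition polygon_ext (R : realType) (d N : nat) (N0 : (0 < N)%N)
    (P : polygon R d N) (j : nat) : 'rV[R]_d := P (Ordinal (ltn_pmod j N0)).

Lemma polygon_extDN (R : realType) (d N : nat) (N0 : (0 < N)%N) (P : polygon R d N) j :
  polygon_ext N0 P (j + N) = polygon_ext N0 P j.
Proof. by congr P; apply/val_inj; rewrite /= modnDr. Qed.

Lemma polygon_ext_ord (R : realType) (d N : nat) (N0 : (0 < N)%N) (P : polygon R d N)
  (i : 'I_N) : P i = polygon_ext N0 P i.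
Proof. by congr P; apply/val_inj; rewrite /= modn_small. Qed.

Lemma polygon_ext_shift (R : realType) (d N : nat) (N0 : (0 < N)%N) (P : polygon R d N)
  (i : 'I_N) m : P (shift i m) = polygon_ext N0 P (i + m).
Proof. by congr P; apply/val_inj. Qed.

(** Puts the regular polygon in the form that [dot_ellipse_chord] expects; the summand [0] is the
    centre. *)
Lemma regular_std_ext (R : realType) (d N : nat) (N0 : (0 < N)%N) (d0 : (0 < d)%N)
    (d1 : (1 < d)%N) (l : R) (t := pi / N%:R) (r := l / (2 * sin t)) (i : nat) :
  polygon_ext N0 (regular_std d N l) i =
  0 + (cos (2 * i%:R * t) *: (r *: delta_mx ord0 (Ordinal d0))
     + sin (2 * i%:R * t) *: (r *: delta_mx ord0 (Ordinal d1))).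
Proof.
have N0' : N%:R != 0 :> R by rewrite pnatr_eq0; lia.
have angle : 2 * i%:R * t = 2 * pi * (i %% N)%:R / N%:R + 2 * (i %/ N)%:R * pi.
  by rewrite {1}(divn_eq i N) natrD natrM /t; field.
rewrite angle cosDn2pi sinDn2pi; apply/rowP => c; rewrite !mxE -!val_eqE /= add0r.
rewrite -/t -/r.
by case: (val c) => [|[|k]] /=; ring.
Qed.

(** The axes are orthogonal of equal length, so the position-dependent angle drops out of the chord
    formula by [cos^2 + sin^2 = 1]. Squares may be compared because [m <= N] makes [sin (m t)]
    non-negative. *)
Lemma enorm_regular_chord (R : realType) (d N m : nat) (l : R) (i : 'I_N)
    (t := pi / N%:R) :
  (2 <= d)%N -> (4 <= N)%N -> (m <= N)%N -> 0 < l ->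
  enorm (regular_std d N l (shift i m) - regular_std d N l i)
  = 2 * (l / (2 * sin t)) * sin (m%:R * t).
Proof.
move=> d2 N4 mN l0.
have N0 : (0 < N)%N by lia.
have d0 : (0 < d)%N by lia.
have st : 0 < sin t by rewrite -[t]mul1r; apply: (@sin_npi_gt0 R N 1); lia.
have sm : 0 <= sin (m%:R * t).
  apply: sin_ge0_pi; rewrite mulr_ge0 ?divr_ge0 ?pi_ge0 //=.
  by rewrite mulrA ler_pdivrMr ?ltr0n // mulrC ler_pM2l ?pi_gt0 // ler_nat.
set r := l / _; have r0 : 0 < r by rewrite divr_gt0 // mulr_gt0.
have q0 : 0 <= 2 * r * sin (m%:R * t) by rewrite mulr_ge0 // mulr_ge0 // ltW.
apply/eqP; rewrite -(@eqrXn2 _ 2) ?enorm_ge0 //; apply/eqP.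
rewrite enorm_sqr (polygon_ext_shift N0) (polygon_ext_ord N0 _ i).
rewrite (dot_ellipse_chord _ _ (regular_std_ext N0 d0 d2 l)) -/t -/r.
rewrite !(dotZl, dotZr) !dot_delta /=; set x := (2 * _ + _) * t.
transitivity (4 * sin (m%:R * t) ^+ 2 * r ^+ 2 * (cos x ^+ 2 + sin x ^+ 2)).
  by ring.
by rewrite cos2Dsin2; ring.
Qed.

(** The isometry is a product of two maps from [exists_reflection]: the first sends [r e0] to [u],
    the second sends the image of [r e1] to [v]. The second fixes [u], which is orthogonal to both
    vectors it exchanges. *)
Lemma regular_of_circle (R : realType) (d N : nat) (P : polygon R d N) (N0 : (0 < N)%N)
    (a u v : 'rV[R]_d) (l : R) (t := pi / N%:R) (r := l / (2 * sin t)) :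
  (2 <= d)%N -> 0 < r ->
  (forall i, polygon_ext N0 P i
     = a + (cos (2 * i%:R * t) *: u + sin (2 * i%:R * t) *: v)) ->
  dot u v = 0 -> dot u u = r ^+ 2 -> dot v v = r ^+ 2 -> is_regular l P.
Proof.
move=> d2 r0 PE uv uu vv.
have d0 : (0 < d)%N by lia.
pose e0 : 'rV[R]_d := delta_mx ord0 (Ordinal d0).
pose e1 : 'rV[R]_d := delta_mx ord0 (Ordinal d2).
have e00 : dot e0 e0 = 1 by rewrite dot_delta eqxx.
have e11 : dot e1 e1 = 1 by rewrite dot_delta eqxx.
have e01 : dot e0 e1 = 0 by rewrite dot_delta.
have [|A [AT Ae0 _]] := @exists_reflection R d (r *: e0) u.
  by rewrite dotZl dotZr e00 uu; ring.
have Adot x y : dot (x *m A) (y *m A) = dot x y.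
  have : (x *m A) *m (y *m A)^T = x *m y^T.
    by rewrite trmx_mul mulmxA -(mulmxA x) AT mulmx1.
  rewrite !dot_mulmx => /matrixP/(_ ord0 ord0).
  by rewrite !mxE.
have [|B [BT Bv Bfix]] := @exists_reflection R d (r *: e1 *m A) v.
  by rewrite Adot dotZl dotZr e11 vv; ring.
have Bu : u *m B = u.
  by apply: Bfix; rewrite uv -Ae0 Adot dotZl dotZr e01 !mulr0.
exists (A *m B), a; split.
  by rewrite trmx_mul mulmxA -(mulmxA A) BT mulmx1.
move=> i; rewrite (polygon_ext_ord N0 P) (polygon_ext_ord N0 (regular_std _ _ _)).
rewrite PE (regular_std_ext N0 d0 d2) -/t -/r -/e0 -/e1 add0r mulmxDl.
rewrite -(scalemxAl (cos _)) -(scalemxAl (sin _)) !mulmxA Ae0 Bu Bv.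
by rewrite addrC.
Qed.

Theorem theorem4p1 (R : realType) (d N m : nat) (l : R) :
  (2 <= d)%N -> (4 <= N)%N -> 0 < l -> (2 <= m)%N -> (m <= N./2)%N ->
  exists2 e : R, 0 < e &
    forall P : polygon R d N,
      equilateral l P ->
      poly_close P (regular_std d N l) e ->
      ~ is_regular l P ->
      Dm m P < Dm m (regular_std d N l).
Proof.
move=> d2 N4 l0 m2 mN; exists 1 => // P Peq _ Pnreg.
(* By contraposition: a diagonal sum at least that of the regular polygon will force [P] to be
   regular. *)
rewrite ltNge; apply/negP => Dge; apply: Pnreg.
have N0 : (0 < N)%N by lia.
have N0' : N%:R != 0 :> R by rewrite pnatr_eq0; lia.
pose t : R := pi / N%:R; pose r : R := l / (2 * sin t).
have st : 0 < sin t by rewrite -[t]mul1r; apply: (@sin_npi_gt0 R N 1); lia.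
have r0 : 0 < r by rewrite divr_gt0 // mulr_gt0.
pose q : R := 2 * r * sin (m%:R * t).
have qE : sin t ^+ 2 * q ^+ 2 = sin (m%:R * t) ^+ 2 * l ^+ 2.
  by rewrite /q /r; field; rewrite gt_eqF.
have Dreg : Dm m (regular_std d N l) = N%:R * q.
  have mN' : (m <= N)%N by lia.
  under [LHS]eq_bigr => i _ do rewrite enorm_regular_chord //.
  by rewrite sumr_const card_ord [RHS]mulr_natl.
pose Y := polygon_ext N0 P.
have YN j : Y (j + N)%N = Y j := polygon_extDN N0 P j.
have chordE k (i : 'I_N) : dot (Y (i + k)%N - Y i) (Y (i + k)%N - Y i)
    = enorm (P (shift i k) - P i) ^+ 2.
  by rewrite enorm_sqr (polygon_ext_shift N0) (polygon_ext_ord N0 P i).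
have edges : \sum_(j < N) dot (Y (j + 1)%N - Y j) (Y (j + 1)%N - Y j) = N%:R * l ^+ 2.
  under eq_bigr => j _ do rewrite chordE Peq.
  by rewrite sumr_const card_ord [RHS]mulr_natl.
have Sle := sum_sqr_chords_le m2 mN YN.
rewrite edges -/t in Sle.
set S := \sum_(j < N) _ in Sle.
have S_le : S <= N%:R * q ^+ 2.
  rewrite -(@ler_pM2l _ (sin t ^+ 2)) ?exprn_gt0 //.
  by rewrite [leRHS]mulrCA qE [leRHS]mulrCA.
(* With [S <= N q^2] and [Dm m P >= N q], this sum of squared deviations is at most zero. It takes
   the place of Cauchy-Schwarz and gives its equality case at once: every diagonal equals [q]. *)
have dev : \sum_(i < N) (enorm (P (shift i m) - P i) - q) ^+ 2 = S - 2 * q * Dm m P + N%:R * q ^+ 2.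
  have -> : N%:R * q ^+ 2 = \sum_(i < N) q ^+ 2.
    by rewrite sumr_const card_ord [LHS]mulr_natl.
  rewrite /S /Dm mulr_sumr -sumrB -big_split /=.
  by apply: eq_bigr => i _; rewrite chordE; ring.
have q0 : 0 <= q.
  rewrite mulr_ge0 ?(mulr_ge0 _ (ltW r0)) //; apply/ltW/sin_npi_gt0; lia.
have dev0 : \sum_(i < N) (enorm (P (shift i m) - P i) - q) ^+ 2 = 0.
  apply: le_anti; apply/andP; split; last by apply: sumr_ge0 => i _; rewrite sqr_ge0.
  rewrite dev; rewrite Dreg in Dge.
  have := ler_wpM2l q0 Dge; rewrite expr2 in S_le *; lra.
have dq (i : 'I_N) : enorm (P (shift i m) - P i) = q.
  move/eqP: dev0; rewrite psumr_eq0 => [/allP|? _]; last by rewrite sqr_ge0.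
  by move=> /(_ i (mem_index_enum i)); rewrite sqrf_eq0 subr_eq0 => /eqP.
have SE : S = N%:R * q ^+ 2.
  rewrite /S; under eq_bigr => j _ do rewrite chordE dq.
  by rewrite sumr_const card_ord [RHS]mulr_natl.
have E0 : forall k (c : 'I_d), (1 < k < N.-1)%N ->
    dft_energy N (fun j => Y j ord0 c) k = 0.
  apply: (dft_energy_eq0_of_sum_sqr_chords_ge m2 mN YN).
  by rewrite edges -/t -/S SE mulrCA -qE mulrCA.
(* The coefficients of [dft_one_mode], collected over the coordinates: [a] is the centroid of the
   vertices, [u] and [v] are conjugate radii of the ellipse. *)
pose a : 'rV[R]_d := \row_c (dft_cos N (fun j => Y j ord0 c) 0 / N%:R).
pose u : 'rV[R]_d := \row_c (2 * dft_cos N (fun j => Y j ord0 c) 1 / N%:R).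
pose v : 'rV[R]_d := \row_c (2 * dft_sin N (fun j => Y j ord0 c) 1 / N%:R).
have YE i : Y i = a + (cos (2 * i%:R * t) *: u + sin (2 * i%:R * t) *: v).
  (* [dft_one_mode] covers indices below [N]; periodicity of both sides extends it to every [i]. *)
  have angle : 2 * i%:R * t = 2 * (i %% N)%:R * t + 2 * (i %/ N)%:R * pi.
    by rewrite {1}(divn_eq i N) natrD natrM /t; field.
  have iN : (i %% N < N)%N by rewrite ltn_pmod.
  have -> : Y i = Y (i %% N)%N by congr P; apply/val_inj; rewrite /= modn_mod.
  rewrite angle cosDn2pi sinDn2pi; apply/rowP => c; rewrite !mxE addrA.
  by rewrite [LHS](dft_one_mode N4 (fun k => E0 k c) iN).
have [j jN|j jN|uv uu vv] := @equilateral_ellipse_circle R d N m Y a u v l (q ^+ 2) N4 m2 mN YE.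
- by have := chordE 1%N (Ordinal jN); rewrite Peq.
- by have := chordE m (Ordinal jN); rewrite dq.
exact: (regular_of_circle d2 r0 YE uv uu vv).
Qed.
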